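(* Let $B$ be a bi-ideal of a semigroup $S$. If $S$ satisfies $M_L$ then so does $B$.
   Context: For a semigroup $S$, $S^1$ denotes the monoid obtained from $S$ by adjoining a new identity $1$. Green's $\mathcal L$-preorder on $S$ is $a\leq_{\mathcal L}b\Leftrightarrow S^1a\subseteq S^1b$; it induces an equivalence relation $\mathcal L$ and a partial order on the set of $\mathcal L$-classes. A semigroup satisfies $M_L$ if every non-empty set of its $\mathcal L$-classes contains a minimal member. A bi-ideal of $S$ is a subset $B$ of $S$ such that $BS^1B\subseteq B$ (in particular, $B$ is a subsemigroup of $S$, and ''$B$ satisfies $M_L$'' refers to $B$ as a semigroup in its own right). *)

(* Defs.v *)
From HB Require Import structures.
From mathcomp Require Import all_boot.
From mathcomp Require Import boolp classical_sets.
Set Implicit Arguments.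
Unset Strict Implicit.
Unset Printing Implicit Defensive.

Local Open Scope classical_set_scope.
Local Open Scope group_scope.

(* A semigroup is a [semigroupType].  Its underlying choice structure is no
   restriction, since [boolp] provides one on every type (and the carrier may
   be empty). *)

(* [adjoin1 S] is S^1: [None] is a fresh identity, adjoined even when S already
   has one. *)
Definition adjoin1 (S : Type) : Type := option S.

Section Adjoin1.
Variable S : semigroupType.

Definition adjoin1_mul (x y : adjoin1 S) : adjoin1 S :=
  match x, y with
  | None, _ => y
  | _, None => x
  | Some a, Some b => Some (a * b)
  end.

Lemma adjoin1_mulA : associative adjoin1_mul.
Proof. by case=> [a|] [b|] [c|] //=; rewrite mulgA. Qed.

Lemma adjoin1_mul1s : left_id (None : adjoin1 S) adjoin1_mul.
Proof. by []. Qed.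

Lemma adjoin1_muls1 : right_id (None : adjoin1 S) adjoin1_mul.
Proof. by case. Qed.

HB.instance Definition _ := Choice.copy (adjoin1 S) (option S).
HB.instance Definition _ := isMonoid.Build (adjoin1 S)
  adjoin1_mulA adjoin1_mul1s adjoin1_muls1.

Definition to_adjoin1 (a : S) : adjoin1 S := Some a.

End Adjoin1.

Definition set_mul (S : semigroupType) (X Y : set S) : set S :=
  [set x * y | x in X & y in Y].

Section Green.
Variable S : semigroupType.
Implicit Types (a b : S) (A C : set S).

(* S^1 a, as a subset of S^1 *)
Definition left_principal a : set (adjoin1 S) :=
  set_mul [set: adjoin1 S] [set to_adjoin1 a].

Definition leL a b : Prop := left_principal a `<=` left_principal b.

Definition eqL a b : Prop := leL a b /\ leL b a.

Definition Lclass a : set S := [set b | eqL a b].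

Definition Lclasses : set (set S) := range Lclass.

(* Only meaningful on [Lclasses], where it does not depend on the chosen
   representatives. *)
Definition leLclass A C : Prop :=
  exists a c, [/\ A a, C c & leL a c].

Definition M_L : Prop :=
  forall X : set (set S), X `<=` Lclasses -> X !=set0 ->
  exists2 A, X A & forall C, X C -> leLclass C A -> C = A.

(* B S^1 B included in B, the products being computed in S^1 *)
Definition bi_ideal (B : set S) : Prop :=
  set_mul (set_mul (@to_adjoin1 S @` B) [set: adjoin1 S]) (@to_adjoin1 S @` B)
  `<=` @to_adjoin1 S @` B.

End Green.

Arguments M_L S : clear implicits.

Lemma bi_ideal_mulg_closed (S : semigroupType) (B : set S) :
  bi_ideal B -> mulg_closed (fun x => x \in B).
Proof.
move=> biB x y; rewrite !unfold_in => /set_mem Bx /set_mem By.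
have [|z Bz [<-]] := biB (to_adjoin1 (x * y)); last exact/mem_set.
exists (to_adjoin1 x); last by exists (to_adjoin1 y); [exists y|].
by exists (to_adjoin1 x); [exists x|exists None].
Qed.

(* A bi-ideal as a semigroup in its own right, with the product of S *)
Definition bi_ideal_type (S : semigroupType) (B : set S) (biB : bi_ideal B) :
  Type := {x : S | x \in B}.

Section BiIdealSemigroup.
Variables (S : semigroupType) (B : set S) (biB : bi_ideal B).

HB.instance Definition _ := SubChoice.copy (bi_ideal_type biB) {x : S | x \in B}.
HB.instance Definition _ := SubChoice_isSubSemigroup.Build S _
  (bi_ideal_type biB) (bi_ideal_mulg_closed biB).

End BiIdealSemigroup.

(* Main.v *)
Require Import Defs.
From mathcomp Require Import all_boot.
From mathcomp Require Import classical_sets.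
From mathcomp Require Import boolp.

Set Implicit Arguments.
Unset Strict Implicit.
Unset Printing Implicit Defensive.

(** In a chain [w = b a], [v = c w], [u = d v] with [b, c, d] in [B], if
    [a = s u] for some [s] in S^1, then [w = b a = b s u = (b s d) v] with
    [b s d] in [B].  So a chain of elements of [B] inside a single L-class of S
    has at most two strict descents for the L-preorder of [B], and it suffices
    to start from an element whose L-class in S is minimal. *)

Local Open Scope classical_set_scope.
Local Open Scope group_scope.

Section LPreorder.
Variable S : semigroupType.
Implicit Types (a b c : S) (W : set S).

(** The adjoined identity accounts for the case [a = b]; any other multiplier lies in the semigroup
    itself. *)
Lemma leLP a b : leL a b <-> a = b \/ exists s, a = s * b.
Proof.
split=> [ab|[->//|[s ->]]].
  have [|[x|] _ [_ -> /=]] := ab (to_adjoin1 a).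
  - by exists None => //; exists (to_adjoin1 a).
  - by case=> <-; right; exists x.
  - by case=> <-; left.
move=> _ [x _ [_ -> <-]].
exists (x * to_adjoin1 s) => //; exists (to_adjoin1 b) => //.
exact: esym (mulgA x (to_adjoin1 s) (to_adjoin1 b)).
Qed.

Lemma Lclass_refl a : Lclass a a.
Proof. by split. Qed.

Lemma leL_trans a b c : leL a b -> leL b c -> leL a c.
Proof. exact: subset_trans. Qed.

Lemma Lclass_eq a b : eqL a b -> Lclass a = Lclass b.
Proof.
move=> [ab ba]; apply/seteqP; split=> x [h k]; split.
- exact: leL_trans ba h.
- exact: leL_trans k ab.
- exact: leL_trans ab h.
- exact: leL_trans k ba.
Qed.

Lemma leLclassE a b : leLclass (Lclass a) (Lclass b) <-> leL a b.
Proof.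
split=> [[x [y [[ax _] [_ yb] xy]]]|ab].
  exact: leL_trans ax (leL_trans xy yb).
by exists a, b; split=> //; exact: Lclass_refl.
Qed.

(** Trades classes for representatives: [W] yields the set of classes of its elements, and [X] the
    set of elements whose class lies in [X]. *)
Lemma M_LP : M_L S <->
  forall W, W !=set0 -> exists2 a, W a & forall w, W w -> leL w a -> leL a w.
Proof.
split=> [mS W [w0 Ww0]|mS X XL [A XA]].
  have [||_ [a Wa <-] mina] := mS (@Lclass S @` W).
  - by move=> _ [w _ <-]; exists w.
  - by exists (Lclass w0), w0.
  exists a => // w Ww wa.
  have wE : Lclass w = Lclass a by apply: mina; [exists w|apply/leLclassE].
  by have [] : Lclass w a by rewrite wE; split.
have [a0 _ a0E] := XL _ XA.
have [|a Xa mina] := mS [set a | X (Lclass a)].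
  by exists a0; rewrite /mkset a0E.
exists (Lclass a) => // C XC; have [c _ cE] := XL _ XC.
rewrite -cE => /leLclassE ca; apply: Lclass_eq; split=> //.
by apply: mina => //; rewrite /mkset cE.
Qed.

(** Strictness excludes the adjoined identity as multiplier. For the preorder of [B], this puts [s]
    in [B]. *)
Lemma leL_nle_mul a b : leL a b -> ~ leL b a -> exists s, a = s * b.
Proof. by move=> /leLP[-> nbb|//]; case: nbb. Qed.

End LPreorder.

Section BiIdeal.
Variables (S : semigroupType) (B : set S) (biB : bi_ideal B).
Notation T := (bi_ideal_type biB).
Implicit Types a b d v : T.

Lemma bi_ideal_mul b d (s : S) : exists e : T, val e = val b * s * val d.
Proof.
have [|x Bx [xE]] := @biB (to_adjoin1 (val b * s * val d)).
  exists (to_adjoin1 (val b * s)).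
    exists (to_adjoin1 (val b)); first by exists (val b) => //; exact/set_mem/valP.
    by exists (to_adjoin1 s).
  by exists (to_adjoin1 (val d)) => //; exists (val d) => //; exact/set_mem/valP.
by exists (Sub x (mem_set Bx)); rewrite SubK.
Qed.

Lemma val_bi_idealM a b : val (a * b) = val a * val b.
Proof. exact: gmulfM. Qed.

Lemma leL_val a b : leL a b -> leL (val a) (val b).
Proof.
move=> /leLP[->//|[s ->]]; apply/leLP; right; exists (val s).
exact: val_bi_idealM.
Qed.

(** If [a = s d v] in S, then [b a = (b s d) v] and the bi-ideal property puts [b s d] in [B]; for
    [s = 1] the multiplier is [b d]. *)
Lemma leL_bi_ideal a b d v :
  leL (val a) (val (d * v)) -> leL (b * a) v.
Proof.
move=> /leLP[|[s]] aE; apply/leLP; right.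
  by exists (b * d); apply/val_inj; rewrite !val_bi_idealM aE !val_bi_idealM mulgA.
have [e eE] := bi_ideal_mul b d s; exists e.
by apply/val_inj; rewrite !val_bi_idealM aE eE val_bi_idealM !mulgA.
Qed.

End BiIdeal.

Theorem theorem4p13 (S : semigroupType) (B : set S) (biB : bi_ideal B) :
  M_L S -> M_L (bi_ideal_type biB).
Proof.
move=> /M_LP mS; apply/M_LP => W [w0 Ww0].
(* [a] is minimal in [W] only for the preorder of S; strict descents in [B] may remain below it. *)
have [|_ [a Wa <-] mina] := mS (val @` W); first by exists (val w0), w0.
apply: contrapT => nomin.
have descend x : W x -> exists y, [/\ W y, leL y x & ~ leL x y].
  move=> Wx; apply: contrapT => nodesc; apply: nomin; exists x => // y Wy yx.
  by apply: contrapT => nxy; apply: nodesc; exists y.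
have [w [Ww wa naw]] := descend a Wa.
have [v [Wv vw nwv]] := descend w Ww.
have [u [Wu uv nvu]] := descend v Wv.
have [b wE] := leL_nle_mul wa naw.
have [d uE] := leL_nle_mul uv nvu.
(* The outer descents supply [b] and [d]; the middle one is contradicted, since minimality of [a] in
   S puts [a] below [u = d v]. *)
apply: nwv; rewrite wE; apply: (leL_bi_ideal (d := d)); rewrite -uE.
apply: mina; first by exists u.
exact/leL_val/(leL_trans uv)/(leL_trans vw).
Qed.
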